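(* Let $X$ be a set, and let $\operatorname{Free}_{\mathsf{Rack}}(X)=(F(X),t)$ be the free rack generated by $X$. Then the free GL-rack $\operatorname{Free}_{\mathsf{GLR}}(X)$ generated by $X$ can be constructed as the product of $\operatorname{Free}_{\mathsf{Rack}}(X)$ and the trivial quandle with underlying set $\mathbb{Z}$: $$\operatorname{Free}_{\mathsf{GLR}}(X)\cong(F(X)\times\mathbb{Z},s,\mathtt{u}),\qquad s_{(y,n)}(x,m):=(t_y(x),m),\qquad\mathtt{u}(x,m):=(x,m+1)$$ for all $x,y\in F(X)$ and $m,n\in\mathbb{Z}$.
   Context: A rack is a pair $(X,s)$ of a set $X$ and a map $s:X\to S_X$, $x\mapsto s_x$ ($S_X$ the group of permutations of $X$), such that $s_xs_y=s_{s_x(y)}s_x$ for all $x,y\in X$. The trivial quandle on a set has $s_x=\operatorname{id}$ for all $x$. A rack homomorphism $(X,s)\to(Y,t)$ is a map $\varphi:X\to Y$ with $\varphi s_x=t_{\varphi(x)}\varphi$ for all $x$. A GL-structure on $R=(X,s)$ is a rack automorphism $\mathtt{u}$ of $R$ with $\mathtt{u}s_x=s_x\mathtt{u}$ for all $x\in X$; $(R,\mathtt{u})=(X,s,\mathtt{u})$ is then a GL-rack. A GL-rack homomorphism $(R_1,\mathtt{u}_1)\to(R_2,\mathtt{u}_2)$ is a rack homomorphism $\varphi$ with $\varphi\mathtt{u}_1=\mathtt{u}_2\varphi$. The free rack (resp. free GL-rack) on a set $X$ is characterized up to isomorphism by the universal property: there is a set map $i$ from $X$ to it such that for every rack (resp.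 GL-rack) $R$ and every set map $\varphi_0$ from $X$ to the underlying set of $R$, there is a unique rack (resp. GL-rack) homomorphism $\varphi$ from it to $R$ with $\varphi i=\varphi_0$. *)

(* Defs.v *)
From mathcomp Require Import all_boot all_algebra.

Set Implicit Arguments.
Unset Strict Implicit.
Unset Printing Implicit Defensive.

(* Permutations of a possibly infinite set are bijective functions, and all
   equations between maps are pointwise, so that no extensionality axiom is
   needed to state them. *)
Definition is_rack (X : Type) (s : X -> X -> X) : Prop :=
  (forall x, bijective (s x)) /\
  (forall x y, s x \o s y =1 s (s x y) \o s x).

Record rack : Type := Rack {
  rack_sort :> Type;
  rack_perm : rack_sort -> rack_sort -> rack_sort;
  rack_permP : is_rack rack_perm
}.

Arguments rack_perm {r} x y.

Definition rack_hom (R S : rack) (phi : R -> S) : Prop :=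
  forall x, phi \o rack_perm x =1 rack_perm (phi x) \o phi.

Definition rack_aut (R : rack) (phi : R -> R) : Prop :=
  rack_hom phi /\ bijective phi.

Definition is_GL_structure (R : rack) (u : R -> R) : Prop :=
  rack_aut u /\ forall x, u \o rack_perm x =1 rack_perm x \o u.

Record GL_rack : Type := GLRack {
  GL_rack_rack :> rack;
  GL_map : GL_rack_rack -> GL_rack_rack;
  GL_mapP : is_GL_structure GL_map
}.

Arguments GL_map {g} x.

Definition GL_hom (G H : GL_rack) (phi : G -> H) : Prop :=
  rack_hom phi /\ phi \o GL_map =1 GL_map \o phi.

Definition GL_isomorphic (G H : GL_rack) : Prop :=
  exists phi : G -> H, GL_hom phi /\ bijective phi.

Definition is_free_rack (X : Type) (F : rack) : Prop :=
  exists i : X -> F, forall (R : rack) (phi0 : X -> R),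
    exists phi : F -> R,
      [/\ rack_hom phi, phi \o i =1 phi0 &
          forall psi : F -> R, rack_hom psi -> psi \o i =1 phi0 -> psi =1 phi].

Definition is_free_GL_rack (X : Type) (F : GL_rack) : Prop :=
  exists i : X -> F, forall (R : GL_rack) (phi0 : X -> R),
    exists phi : F -> R,
      [/\ GL_hom phi, phi \o i =1 phi0 &
          forall psi : F -> R, GL_hom psi -> psi \o i =1 phi0 -> psi =1 phi].

Lemma trivial_is_rack (X : Type) : is_rack (fun _ y : X => y).
Proof. by split=> [x|x y z //]; exists id. Qed.

Definition trivial_quandle (X : Type) : rack := Rack (@trivial_is_rack X).

Lemma prod_is_rack (R S : rack) :
  is_rack (fun p q : R * S => (rack_perm p.1 q.1, rack_perm p.2 q.2)).
Proof.
have [bR cR] := rack_permP R; have [bS cS] := rack_permP S.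
split=> [[a b]|[a b] [c d] [e f]] /=.
  have [g gK Kg] := bR a; have [h hK Kh] := bS b.
  by exists (fun q => (g q.1, h q.2)) => -[c d] /=; rewrite ?gK ?hK ?Kg ?Kh.
by congr pair; [exact: cR | exact: cS].
Qed.

Definition prod_rack (R S : rack) : rack := Rack (@prod_is_rack R S).

(* Main.v *)
Require Import Defs.
From mathcomp Require Import all_boot all_algebra.

(** Two facts about a GL-structure [u] on [R] do all the work: since
    [u s_x = s_(u x) u = s_x u] and [u] is bijective, [s_(u x) = s_x]; and [u]
    commutes with every [s_x]. Hence a rack homomorphism [phi : F(X) -> R] extends to
    the GL-homomorphism [(x, m) |-> u^m (phi x)] on [F(X) x Z], and this is the only
    extension because [(x, m)] is the [m]-th iterate of [(x, 0)] under the
    GL-structure, while [x |-> (x, 0)] is a rack homomorphism. *)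

Set Implicit Arguments.
Unset Strict Implicit.
Unset Printing Implicit Defensive.

Import GRing.Theory.
Local Open Scope ring_scope.

(** The equivalence in the step carries [P] downwards as well, so it reaches the negative
    integers. *)
Lemma int_succ_ind (P : int -> Prop) :
  P 0 -> (forall m, P m <-> P (m + 1)) -> forall m, P m.
Proof.
move=> P0 PS; elim/int_rect => [//|n IH|n IH].
- by rewrite -addn1 PoszD; apply/(PS n%:Z).
- by apply/PS; rewrite -addn1 PoszD opprD addrNK.
Qed.

(** When [v] inverts [u] this is the power [u^m]; [Negz n] stands for [-(n+1)], hence [n.+1]. *)
Definition iterz (T : Type) (u v : T -> T) (m : int) : T -> T :=
  match m with Posz n => iter n u | Negz n => iter n.+1 v end.

Lemma iterzS (T : Type) (u v : T -> T) (m : int) (x : T) :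
  cancel v u -> iterz u v (m + 1) x = u (iterz u v m x).
Proof.
move=> vK; case: m => n; first by rewrite -PoszD addn1.
have -> : Negz n + 1 = - n%:Z by rewrite NegzE -addn1 PoszD opprD addrNK.
(* For [n = 0] the sum lands in the [Posz] branch, otherwise in [Negz]; in both, [u] cancels the
   outermost [v]. *)
by case: n => [|n] /=; rewrite vK.
Qed.

Lemma int_orbit_eq (T : Type) (u : T -> T) (f g : int -> T) :
  injective u -> (forall m, f (m + 1) = u (f m)) ->
  (forall m, g (m + 1) = u (g m)) -> f 0 = g 0 -> f =1 g.
Proof.
move=> u_inj fS gS fg0; apply: int_succ_ind => // m; rewrite fS gS.
by split=> [-> //|/u_inj].
Qed.

Lemma rack_perm_GL_map (G : GL_rack) (x y : G) :
  rack_perm (GL_map x) y = rack_perm x y.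
Proof.
have [[hu [v uK vK]] cu] := GL_mapP G.
by rewrite -[y]vK; have := hu x (v y); rewrite (cu x (v y)).
Qed.

Lemma GL_hom_comp (G H K : GL_rack) (f : H -> K) (g : G -> H) :
  GL_hom f -> GL_hom g -> GL_hom (f \o g).
Proof.
move=> [rf uf] [rg ug]; split=> [x y|x] /=.
- by rewrite [g _]rg [f _]rf.
- by rewrite [g _]ug [f _]uf.
Qed.

Lemma free_GL_rack_unique (X : Type) (G H : GL_rack) :
  is_free_GL_rack X G -> is_free_GL_rack X H -> GL_isomorphic G H.
Proof.
move=> [i freeG] [j freeH].
have [f [hf fi _]] := freeG H j.
have [g [hg gj _]] := freeH G i.
exists f; split=> //; exists g => x.
- have [h [_ _ h_uniq]] := freeG G i.
  (* Both [g \o f] and [id] are GL-endomorphisms extending [i], so both equal [h]. *)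
  rewrite -[g _]/((g \o f) x) h_uniq; first 1 last.
  + exact: GL_hom_comp.
  + by move=> a /=; rewrite [f _]fi [g _]gj.
  by rewrite -(h_uniq id).
- have [h [_ _ h_uniq]] := freeH H j.
  rewrite -[f _]/((f \o g) x) h_uniq; first 1 last.
  + exact: GL_hom_comp.
  + by move=> a /=; rewrite [g _]gj [f _]fi.
  by rewrite -(h_uniq id).
Qed.

Definition shift (F : rack) (p : prod_rack F (trivial_quandle int)) :
  prod_rack F (trivial_quandle int) := (p.1, p.2 + 1).

Lemma shift_is_GL_structure (F : rack) : is_GL_structure (@shift F).
Proof.
(* The rack acts on the first coordinate only and [shift] on the second, so only bijectivity is
   left. *)
split=> //; split=> //.
by exists (fun p => (p.1, p.2 - 1)) => -[x m]; rewrite /shift /= ?addrK ?subrK.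
Qed.

Lemma shift_free (X : Type) (F : rack) :
  is_free_rack X F -> is_free_GL_rack X (GLRack (@shift_is_GL_structure F)).
Proof.
move=> [i freeF]; exists (fun a => (i a, 0)) => R phi0.
have [phi [hphi phi_i phi_uniq]] := freeF R phi0.
have [[_ [v uK vK]] cu] := GL_mapP R.
have iterS m x := @iterzS R _ _ m x vK.
have perm_iter m (x y : R) : rack_perm (iterz GL_map v m x) y = rack_perm x y.
  by elim/int_succ_ind: m => // m; rewrite iterS rack_perm_GL_map.
have iter_perm m (x y : R) :
    iterz GL_map v m (rack_perm x y) = rack_perm x (iterz GL_map v m y).
  elim/int_succ_ind: m => // m; rewrite !iterS -[rack_perm x (GL_map _)]cu /=.
  by split=> [-> //|/(can_inj uK)].
exists (fun p => iterz GL_map v p.2 (phi p.1)); split.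
- split=> [[y n] [x m]|[x m]] /=; last exact: iterS.
  (* The power [m] passes inside the permutation, and the power [n] on the acting element
     disappears. *)
  by rewrite [phi _]hphi /= iter_perm perm_iter.
- by move=> a /=; rewrite [phi _]phi_i.
- move=> psi [rpsi upsi] psi_i [x m] /=.
  (* For fixed [x], both sides are orbits of [GL_map] indexed by [k], so comparing them at [k = 0]
     suffices; there the uniqueness of [phi] decides. *)
  apply: (@int_orbit_eq _ GL_map (fun k => psi (x, k))
           (fun k => iterz GL_map v k (phi x))) => [|k|k|/=].
  + exact: can_inj uK.
  + exact: (upsi (x, k)).
  + exact: iterS.
  + apply: (phi_uniq (fun z => psi (z, 0))) => // y z.
    exact: (rpsi (y, 0) (z, 0)).
Qed.

Local Close Scope ring_scope.

Theorem theorem3p20 (X : Type) (F : rack) (hF : is_free_rack X F) :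
  let P : rack := prod_rack F (trivial_quandle int) in
  let u : P -> P := fun p => (p.1, (p.2 + 1)%R) in
  (forall (x y : F) (m n : int),
     @rack_perm P (y, n) (x, m) = (rack_perm y x, m)) /\
  exists hu : is_GL_structure u,
    is_free_GL_rack X (GLRack hu) /\
    (forall G : GL_rack, is_free_GL_rack X G -> GL_isomorphic G (GLRack hu)).
Proof.
(* [u] is convertible to [shift]. *)
move=> P u; split=> //; exists (@shift_is_GL_structure F).
have freeP := shift_free hF.
by split=> // G freeG; exact: free_GL_rack_unique freeG freeP.
Qed.
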